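(* Let $\mathbf{w}^{(k)}\in\mathbb{R}^{R(m+n+p)}$ be the point at the $k$-th iteration, with associated factor matrices $\mathbf{X}=[\mathbf{x}_1,\ldots,\mathbf{x}_R]\in\mathbb{R}^{m\times R}$, $\mathbf{Y}=[\mathbf{y}_1,\ldots,\mathbf{y}_R]\in\mathbb{R}^{n\times R}$, $\mathbf{Z}=[\mathbf{z}_1,\ldots,\mathbf{z}_R]\in\mathbb{R}^{p\times R}$, and let $\mathbf{A}=\mathbf{J}_f(\mathbf{w}^{(k)})$ be the Jacobian matrix of the residual map $f$ at $\mathbf{w}^{(k)}$. Then $$\mathbf{A}^T\mathbf{A}=\begin{bmatrix}\mathbf{B}_X&\mathbf{B}_{XY}&\mathbf{B}_{XZ}\\ \mathbf{B}_{XY}^T&\mathbf{B}_Y&\mathbf{B}_{YZ}\\ \mathbf{B}_{XZ}^T&\mathbf{B}_{YZ}^T&\mathbf{B}_Z\end{bmatrix},$$ where each of the matrices $\mathbf{B}_X,\mathbf{B}_Y,\mathbf{B}_Z,\mathbf{B}_{XY},\mathbf{B}_{XZ},\mathbf{B}_{YZ}$ is an $R\times R$ block matrix whose block in block-row $r$ and block-column $s$ ($1\le r,s\le R$) is respectively - $\mathbf{B}_X$: $\langle\mathbf{y}_r,\mathbf{y}_s\rangle\langle\mathbf{z}_r,\mathbf{z}_s\rangle\,\mathbf{I}_m$; - $\mathbf{B}_Y$: $\langle\mathbf{x}_r,\mathbf{x}_s\rangle\langle\mathbf{z}_r,\mathbf{z}_s\rangle\,\mathbf{I}_n$; - $\mathbf{B}_Z$: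 $\langle\mathbf{x}_r,\mathbf{x}_s\rangle\langle\mathbf{y}_r,\mathbf{y}_s\rangle\,\mathbf{I}_p$; - $\mathbf{B}_{XY}$: $\langle\mathbf{z}_r,\mathbf{z}_s\rangle\,\mathbf{x}_s\mathbf{y}_r^T$; - $\mathbf{B}_{XZ}$: $\langle\mathbf{y}_r,\mathbf{y}_s\rangle\,\mathbf{x}_s\mathbf{z}_r^T$; - $\mathbf{B}_{YZ}$: $\langle\mathbf{x}_r,\mathbf{x}_s\rangle\,\mathbf{y}_s\mathbf{z}_r^T$.
   Context: Let $m,n,p,R$ be positive integers and let $\mathcal{T}\in\mathbb{R}^{m\times n\times p}$ be a fixed tensor with entries $\mathcal{T}_{ijk}$. A vector $\mathbf{w}\in\mathbb{R}^{R(m+n+p)}$ is identified with a triple of factor matrices $\mathbf{X}\in\mathbb{R}^{m\times R}$, $\mathbf{Y}\in\mathbb{R}^{n\times R}$, $\mathbf{Z}\in\mathbb{R}^{p\times R}$ by $\mathbf{w}=\begin{bmatrix}vec(\mathbf{X})\\vec(\mathbf{Y})\\vec(\mathbf{Z})\end{bmatrix}$, where $vec$ stacks the columns of a matrix, the first column at the top. The residual map $f:\mathbb{R}^{R(m+n+p)}\to\mathbb{R}^{mnp}$, $f=(f_{111},f_{112},\ldots,f_{mnp})$, is defined by $f_{ijk}(\mathbf{w})=\mathcal{T}_{ijk}-\sum_{r=1}^R x_{ir}y_{jr}z_{kr}$, and $\mathbf{J}_f(\mathbf{w})$ is its $mnp\times R(m+n+p)$ Jacobian matrix, with columns ordered as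 the coordinates of $\mathbf{w}$. The points $\mathbf{w}^{(k)}$ are iterates of a damped Gauss-Newton method for minimizing $F=\frac12\|f\|^2$ started from an arbitrary point. $\langle\cdot,\cdot\rangle$ is the Euclidean inner product and $\mathbf{I}_d$ is the $d\times d$ identity matrix. *)

(* Defs.v *)
From mathcomp Require Export all_boot all_order all_algebra.
From mathcomp Require Export reals topology normedtype derive.
Export Order.TTheory GRing.Theory Num.Theory.
Export numFieldNormedType.Exports.

Set Implicit Arguments.
Unset Strict Implicit.
Unset Printing Implicit Defensive.

#[global] Open Scope ring_scope.

(* MathComp types R x R block matrices with d1 x d2 blocks as
   'M_(\sum_(r < R) d1, \sum_(r < R) d2).  The dimension R(m+n+p) is therefore
   written Rm + Rn + Rp, where Rd is spelled \sum_(r < R) d, so that no cast is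
   needed. *)
Notation wdim m n p R :=
  (\sum_(r < R) m + \sum_(r < R) n + \sum_(r < R) p)%N.

Section Vec.
Variables (K : pzRingType) (d R : nat).

(* Stacks the columns, unlike mxvec, which goes through the rows. *)
Definition vec (M : 'M[K]_(d, R)) : 'cV[K]_(\sum_(r < R) d) :=
  \mxcol_(r < R) col r M.

Definition unvec (v : 'cV[K]_(\sum_(r < R) d)) : 'M[K]_(d, R) :=
  \matrix_(i, r) submxcol v r i 0.

Lemma vecK : cancel vec unvec.
Proof. by move=> M; apply/matrixP => i r; rewrite mxE mxcolK mxE. Qed.

Lemma unvecK : cancel unvec vec.
Proof.
move=> v; rewrite -[RHS]submxcolK; apply/eq_mxcol => r.
by apply/matrixP => i j; rewrite mxE mxE ord1.
Qed.

End Vec.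

Section Factors.
Variables (K : pzRingType) (m n p R : nat).

Definition stack (X : 'M[K]_(m, R)) (Y : 'M[K]_(n, R)) (Z : 'M[K]_(p, R)) :
  'cV[K]_(wdim m n p R) := col_mx (col_mx (vec X) (vec Y)) (vec Z).

Definition factorX (w : 'cV[K]_(wdim m n p R)) : 'M[K]_(m, R) :=
  unvec (usubmx (usubmx w)).
Definition factorY (w : 'cV[K]_(wdim m n p R)) : 'M[K]_(n, R) :=
  unvec (dsubmx (usubmx w)).
Definition factorZ (w : 'cV[K]_(wdim m n p R)) : 'M[K]_(p, R) :=
  unvec (dsubmx w).

Lemma factorsK w : stack (factorX w) (factorY w) (factorZ w) = w.
Proof. by rewrite /stack !unvecK !vsubmxK. Qed.

Lemma stackK X Y Z :
  [/\ factorX (stack X Y Z) = X, factorY (stack X Y Z) = Y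
    & factorZ (stack X Y Z) = Z].
Proof.
by split; rewrite /factorX /factorY /factorZ ?(col_mxKu, col_mxKd) vecK.
Qed.

End Factors.

(* The components of the residual are in the order 111, 112, ..., mnp: mxvec
   lists a matrix row by row, so the last index varies fastest. *)
Definition residual (K : pzRingType) (m n p R : nat)
    (T : 'I_m -> 'I_n -> 'I_p -> K) (w : 'cV[K]_(wdim m n p R)) :
    'cV[K]_(m * (n * p)) :=
  (mxvec (\matrix_(i < m) mxvec (\matrix_(j < n, k < p)
    (T i j k - \sum_(r < R) factorX w i r * factorY w j r * factorZ w k r))))^T.

(* derive.jacobian acts on row vectors by right multiplication, so it is the
   transpose of the usual matrix of partial derivatives. *)
Definition Jacobian (K : numFieldType) (a b : nat)
    (f : 'cV[K]_a -> 'cV[K]_b) (w : 'cV[K]_a) : 'M[K]_(b, a) :=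
  (jacobian (fun v : 'rV[K]_a => (f v^T)^T) w^T)^T.

Definition inner (K : pzRingType) (d : nat) (u v : 'cV[K]_d) : K :=
  \sum_(i < d) u i 0 * v i 0.

(* Main.v *)
Require Import Defs.
From HB Require Import structures.
From mathcomp Require Import boolp functions ring.

(** Column [(r, i)] of the X-part of the Jacobian is the rank-one tensor
    [- e_i (x) y_r (x) z_r], and likewise for the Y- and Z-parts.  Every entry
    of [A^T A] is thus an inner product of two rank-one tensors, which is the
    product of the inner products of their factors. *)

Section TensorGram.
Set Implicit Arguments.
Unset Strict Implicit.

(** * Rank-one tensors, their inner products and Gram matrices *)

Section Kron.
Variable K : comPzRingType.

(** Flattening by [mxvec] follows the index order of [residual], so a nested [kron u (kron v w)] is
    a rank-one tensor in residual coordinates. *)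
Definition kron (a b : nat) (u : 'cV[K]_a) (v : 'cV[K]_b) : 'cV[K]_(a * b) :=
  (mxvec (u *m v^T))^T.

Lemma kronE a b (u : 'cV[K]_a) (v : 'cV[K]_b) i j :
  kron u v (mxvec_index i j) 0 = u i 0 * v j 0.
Proof. by rewrite mxE mxvecE mxE big_ord1 mxE. Qed.

Lemma kron_linearl a b (v : 'cV[K]_b) : linear (fun u : 'cV[K]_a => kron u v).
Proof.
move=> c u u'; apply/colP => q; case/mxvec_indexP: q => i j.
by rewrite kronE [RHS]mxE [X in _ = X + _]mxE !kronE !mxE; ring.
Qed.

Lemma kron_linearr a b (u : 'cV[K]_a) : linear (@kron a b u).
Proof.
move=> c v v'; apply/colP => q; case/mxvec_indexP: q => i j.
by rewrite kronE [RHS]mxE [X in _ = X + _]mxE !kronE !mxE; ring.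
Qed.

(** Indexing by pairs through [mxvec_index] gives a double sum of products, which separates. *)
Lemma inner_kron a b (u u' : 'cV[K]_a) (v v' : 'cV[K]_b) :
  inner (kron u v) (kron u' v') = inner u u' * inner v v'.
Proof.
rewrite /inner (reindex _ (curry_mxvec_bij _ _)) /= mulr_suml.
under [RHS]eq_bigr do rewrite mulr_sumr.
by rewrite pair_bigA; apply: eq_bigr => -[i j] _ /=; rewrite !kronE; ring.
Qed.

Lemma innerC d (u v : 'cV[K]_d) : inner u v = inner v u.
Proof. by apply: eq_bigr => i _; rewrite mulrC. Qed.

Lemma inner_deltal d (u : 'cV[K]_d) i : inner (delta_mx i 0) u = u i 0.
Proof.
rewrite /inner (bigD1 i) //= mxE !eqxx mul1r big1 ?addr0 // => j /negPf ji.
by rewrite mxE ji mul0r.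
Qed.

Lemma inner_deltar d (u : 'cV[K]_d) i : inner u (delta_mx i 0) = u i 0.
Proof. by rewrite innerC inner_deltal. Qed.

Lemma innerNN d (u v : 'cV[K]_d) : inner (- u) (- v) = inner u v.
Proof. by apply: eq_bigr => i _; rewrite !mxE mulrNN. Qed.

Definition mx_of_cols (a d : nat) (f : 'I_d -> 'cV[K]_a) : 'M[K]_(a, d) :=
  \matrix_(q, i) f i q 0.

Lemma gram_mx_of_cols a d e (f : 'I_d -> 'cV[K]_a) (g : 'I_e -> 'cV[K]_a) :
  (mx_of_cols f)^T *m mx_of_cols g = \matrix_(i, j) inner (f i) (g j).
Proof.
by apply/matrixP => i j; rewrite !mxE; apply: eq_bigr => q _; rewrite !mxE.
Qed.

Lemma gram_mxrow (N a b R : nat) (f : 'I_R -> 'I_a -> 'cV[K]_N)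
    (g : 'I_R -> 'I_b -> 'cV[K]_N) :
  (\mxrow_r mx_of_cols (f r))^T *m \mxrow_s mx_of_cols (g s) =
  \mxblock_(r, s) \matrix_(i, j) inner (f r i) (g s j).
Proof.
rewrite tr_mxrow mul_mxcol_mxrow; apply: eq_mxblock => r s.
exact: gram_mx_of_cols.
Qed.

(** Expand [u] in the standard basis. This is how the Jacobian blocks, defined by their columns, act
    on arbitrary vectors. *)
Lemma mul_mx_of_cols a d (f : 'cV[K]_d -> 'cV[K]_a) (u : 'cV[K]_d) :
  linear f -> mx_of_cols (fun i => f (delta_mx i 0)) *m u = f u.
Proof.
move=> f_lin; pose fL : {linear _ -> _} :=
  HB.pack f (GRing.isLinear.Build _ _ _ _ f f_lin).
rewrite -[f]/(fL : _ -> _) [in RHS](matrix_sum_delta u) linear_sum.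
apply/colP => q; rewrite mxE summxE; apply: eq_bigr => i _.
by rewrite big_ord1 linearZ !mxE mulrC.
Qed.

End Kron.

(** * Differentials computed component by component *)

Section Differential.
Variable K : numFieldType.

Lemma is_diff_sum (V W : normedModType K) (I : finType) (f df : I -> V -> W) x :
  (forall i, is_diff x (f i) (df i)) ->
  is_diff x (\sum_i f i) (\sum_i df i).
Proof.
move=> f_diff; elim/big_ind2: _ => //; first exact: is_diff_cst.
by move=> g dg h dh; exact: is_diffD.
Qed.

(** [f] is the sum of its coordinates times fixed basis vectors; each summand is a scalar function
    followed by a linear map. *)
Lemma is_diff_rV (V : normedModType K) (b : nat) (f df : V -> 'rV[K]_b) x :
    (forall q, is_diff x (fun v => f v 0 q) (fun v => df v 0 q)) ->
  is_diff x f df.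
Proof.
move=> f_diff.
have sumE (g : V -> 'rV[K]_b) :
    g = \sum_q (fun v => g v 0 q *: (delta_mx 0 q : 'rV[K]_b)).
  by apply/funext => v; rewrite fct_sumE -row_sum_delta.
rewrite (sumE f) (sumE df); apply: is_diff_sum => q.
exact: (is_diff_comp (f_diff q) (is_diff_scalel _ _)).
Qed.

Lemma is_diff_coord (a b : nat) (M : 'M[K]_(a, b)) i j :
  is_diff M (fun N : 'M[K]_(a, b) => N i j) (fun N => N i j).
Proof.
pose c (N : 'M[K]_(a, b)) : K := N i j.
have c_lin : linear c by move=> s u v; rewrite /c !mxE.
pose cL : {linear _ -> _} := HB.pack c (GRing.isLinear.Build _ _ _ _ c c_lin).
apply: DiffDef; first exact: differentiable_coord.
rewrite -[fun N => _]/(cL : _ -> _).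
by rewrite diff_lin //; exact: coord_continuous.
Qed.

(** Gives access to the Jacobian through its action on vectors: a candidate differential is checked
    one scalar component at a time. *)
Lemma mul_Jacobian (a b : nat) (f df : 'cV[K]_a -> 'cV[K]_b) w u :
    (forall q, is_diff (w^T) (fun v : 'rV[K]_a => f v^T q 0)
                           (fun v => df v^T q 0)) ->
  Jacobian f w *m u = df u.
Proof.
move=> f_diff; pose F (v : 'rV[K]_a) := (f v^T)^T.
have F_diff : is_diff (w^T) F (fun v => (df v^T)^T).
  apply: is_diff_rV => q; rewrite /F.
  under eq_fun do rewrite mxE.
  under [X in is_diff_def _ _ X]eq_fun do rewrite mxE.
  exact: f_diff.
apply: trmx_inj; rewrite trmx_mul trmxK mul_rV_lin1.
by rewrite -/F diff_val trmxK.
Qed.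

End Differential.

(** * The Jacobian of the residual map *)

Section Residual.
Variables (K : numFieldType) (m n p R : nat).
Variables (T : 'I_m -> 'I_n -> 'I_p -> K) (w : 'cV[K]_(wdim m n p R)).

Let x (r : 'I_R) := col r (factorX w).
Let y (r : 'I_R) := col r (factorY w).
Let z (r : 'I_R) := col r (factorZ w).

Definition JX (r : 'I_R) : 'M[K]_(m * (n * p), m) :=
  mx_of_cols (fun i => - kron (delta_mx i 0) (kron (y r) (z r))).
Definition JY (r : 'I_R) : 'M[K]_(m * (n * p), n) :=
  mx_of_cols (fun j => - kron (x r) (kron (delta_mx j 0) (z r))).
Definition JZ (r : 'I_R) : 'M[K]_(m * (n * p), p) :=
  mx_of_cols (fun k => - kron (x r) (kron (y r) (delta_mx k 0))).

Lemma residualE (v : 'cV[K]_(wdim m n p R)) i j k :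
  residual T v (mxvec_index i (mxvec_index j k)) 0 =
  T i j k - \sum_(r < R) factorX v i r * factorY v j r * factorZ v k r.
Proof. by rewrite !(mxE, mxvecE). Qed.

(** An entry of a factor matrix is one fixed coordinate of [v]: [tagnat.Rank r i] is the position of
    entry [i] of block [r], and the shifts select the X-part. *)
Lemma is_diff_factorX i r :
  is_diff (w^T) (fun v : 'rV[K]_(wdim m n p R) => factorX v^T i r)
              (fun v => factorX v^T i r).
Proof.
have -> : (fun v : 'rV[K]_(wdim m n p R) => factorX v^T i r) =
    (fun v => v 0 (lshift _ (lshift _ (tagnat.Rank r i)))).
  by apply/funext => v; rewrite !mxE.
exact: is_diff_coord.
Qed.

Lemma is_diff_factorY j r :
  is_diff (w^T) (fun v : 'rV[K]_(wdim m n p R) => factorY v^T j r)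
              (fun v => factorY v^T j r).
Proof.
have -> : (fun v : 'rV[K]_(wdim m n p R) => factorY v^T j r) =
    (fun v => v 0 (lshift _ (rshift _ (tagnat.Rank r j)))).
  by apply/funext => v; rewrite !mxE.
exact: is_diff_coord.
Qed.

Lemma is_diff_factorZ k r :
  is_diff (w^T) (fun v : 'rV[K]_(wdim m n p R) => factorZ v^T k r)
              (fun v => factorZ v^T k r).
Proof.
have -> : (fun v : 'rV[K]_(wdim m n p R) => factorZ v^T k r) =
    (fun v => v 0 (rshift _ (tagnat.Rank r k))).
  by apply/funext => v; rewrite !mxE.
exact: is_diff_coord.
Qed.

Lemma mul_JX r u : JX r *m u = - kron u (kron (y r) (z r)).
Proof.
apply: (mul_mx_of_cols (f := fun u => - kron u (kron (y r) (z r)))) => c v v'.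
by rewrite kron_linearl opprD scalerN.
Qed.

Lemma mul_JY r u : JY r *m u = - kron (x r) (kron u (z r)).
Proof.
apply: (mul_mx_of_cols (f := fun u => - kron (x r) (kron u (z r)))) => c v v'.
by rewrite kron_linearl kron_linearr opprD scalerN.
Qed.

Lemma mul_JZ r u : JZ r *m u = - kron (x r) (kron (y r) u).
Proof.
apply: (mul_mx_of_cols (f := fun u => - kron (x r) (kron (y r) u))) => c v v'.
by rewrite !kron_linearr opprD scalerN.
Qed.

(** Product rule: differentiating x_ir y_jr z_kr along [u] replaces one factor at a time by the
    matching entry of [u], whence three sums. *)
Lemma mul_Jacobian_residual (u : 'cV[K]_(wdim m n p R)) :
  Jacobian (residual T) w *m u =
  \sum_r JX r *m col r (factorX u) + \sum_r JY r *m col r (factorY u)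
  + \sum_r JZ r *m col r (factorZ u).
Proof.
pose dres (v : 'cV[K]_(wdim m n p R)) : 'cV[K]_(m * (n * p)) :=
  \sum_r JX r *m col r (factorX v) + \sum_r JY r *m col r (factorY v)
  + \sum_r JZ r *m col r (factorZ v).
apply: (@mul_Jacobian _ _ _ _ dres) => q.
case/mxvec_indexP: q => i q; case/mxvec_indexP: q => j k.
pose fX r (v : 'rV[K]_(wdim m n p R)) := factorX v^T i r.
pose fY r (v : 'rV[K]_(wdim m n p R)) := factorY v^T j r.
pose fZ r (v : 'rV[K]_(wdim m n p R)) := factorZ v^T k r.
(* Stated in the ring of functions, where the differentiation rules apply. *)
have -> : (fun v : 'rV[K]_(wdim m n p R) =>
    residual T v^T (mxvec_index i (mxvec_index j k)) 0) =
    cst (T i j k) - \sum_r (fX r * fY r * fZ r).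
  by apply/funext => v; rewrite residualE /GRing.add /= opprfctE fct_sumE.
have diff_term r : is_diff (w^T) (fX r * fY r * fZ r)
    ((fX r * fY r) w^T *: fZ r +
     fZ r w^T *: (fX r w^T *: fY r + fY r w^T *: fX r)).
  apply: is_diffM; last exact: is_diff_factorZ.
  by apply: is_diffM; [exact: is_diff_factorX | exact: is_diff_factorY].
apply: is_diff_eq (is_diffB (is_diff_cst _ _) (is_diff_sum diff_term)) _.
apply/funext => v; rewrite sub0r opprfctE fct_sumE /dres.
(* Without the explicit type, big_split would also match the sums in wdim. *)
rewrite -!(@big_split 'cV[K]_(m * (n * p))) /= summxE -sumrN.
apply: eq_bigr => r _.
(* A full [mxE] would expand the products by [JX], [JY] and [JZ] before their closed forms can be
   used. *)
have addE N (c d : 'cV[K]_N) l : (c + d) l 0 = c l 0 + d l 0 by rewrite mxE.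
have oppE N (c : 'cV[K]_N) l : (- c) l 0 = - c l 0 by rewrite mxE.
rewrite !addE mul_JX mul_JY mul_JZ !oppE !kronE.
have colE N (M : 'M[K]_(N, R)) l : col r M l 0 = M l r by rewrite mxE.
(* By conversion, the left-hand side is the product-rule differential evaluated at [v]; a polynomial
   identity remains. *)
rewrite /x /y /z !colE -[LHS]/(- (fX r w^T * fY r w^T * fZ r v +
  fZ r w^T * (fX r w^T * fY r v + fY r w^T * fX r v))) /fX /fY /fZ !trmxK.
ring.
Qed.

(** Both sides act alike on every basis vector, so their columns agree. *)
Lemma Jacobian_residual :
  Jacobian (residual T) w =
  row_mx (row_mx (\mxrow_r JX r) (\mxrow_r JY r)) (\mxrow_r JZ r).
Proof.
apply: trmx_inj; apply/row_matrixP => i; apply: trmx_inj.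
rewrite !rowE !trmx_mul !trmxK mul_Jacobian_residual.
set u := (delta_mx 0 i)^T.
(* Splitting [u] into its three factor parts matches the block structure of the row. *)
by rewrite -[in RHS](factorsK u) /stack !mul_row_col /vec !mul_mxrow_mxcol.
Qed.

End Residual.

End TensorGram.

Theorem theorem4p5 (K : realType) (m n p R : nat)
    (m_gt0 : (0 < m)%N) (n_gt0 : (0 < n)%N) (p_gt0 : (0 < p)%N)
    (R_gt0 : (0 < R)%N)
    (T : 'I_m -> 'I_n -> 'I_p -> K) (wk : 'cV[K]_(wdim m n p R)) :
  let x (r : 'I_R) := col r (factorX wk) in
  let y (r : 'I_R) := col r (factorY wk) in
  let z (r : 'I_R) := col r (factorZ wk) in
  let A := Jacobian (residual T) wk in
  let BX := \mxblock_(r < R, s < R)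
              ((inner (y r) (y s) * inner (z r) (z s)) *: (1%:M : 'M[K]_m)) in
  let BY := \mxblock_(r < R, s < R)
              ((inner (x r) (x s) * inner (z r) (z s)) *: (1%:M : 'M[K]_n)) in
  let BZ := \mxblock_(r < R, s < R)
              ((inner (x r) (x s) * inner (y r) (y s)) *: (1%:M : 'M[K]_p)) in
  let BXY := \mxblock_(r < R, s < R) (inner (z r) (z s) *: (x s *m (y r)^T)) in
  let BXZ := \mxblock_(r < R, s < R) (inner (y r) (y s) *: (x s *m (z r)^T)) in
  let BYZ := \mxblock_(r < R, s < R) (inner (x r) (x s) *: (y s *m (z r)^T)) in
  A^T *m A =
    col_mx (col_mx (row_mx (row_mx BX BXY) BXZ)
                   (row_mx (row_mx BXY^T BY) BYZ))
           (row_mx (row_mx BXZ^T BYZ^T) BZ).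
Proof.
move=> x y z A BX BY BZ BXY BXZ BYZ.
pose entryE := (innerNN, inner_kron, inner_deltal, inner_deltar).
(* In a diagonal block both basis vectors sit in the same tensor factor, and their inner product is
   an entry of the identity. *)
have XX : (\mxrow_r JX wk r)^T *m \mxrow_r JX wk r = BX.
  rewrite gram_mxrow; apply: eq_mxblock => r s; apply/matrixP => i j.
  by rewrite !mxE !entryE !mxE mulrC eqxx andbT.
have YY : (\mxrow_r JY wk r)^T *m \mxrow_r JY wk r = BY.
  rewrite gram_mxrow; apply: eq_mxblock => r s; apply/matrixP => i j.
  by rewrite !mxE !entryE !mxE eqxx andbT; ring.
have ZZ : (\mxrow_r JZ wk r)^T *m \mxrow_r JZ wk r = BZ.
  rewrite gram_mxrow; apply: eq_mxblock => r s; apply/matrixP => i j.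
  by rewrite !mxE !entryE !mxE eqxx andbT; ring.
(* Here the basis vectors sit in different factors: e_i picks entry i of x_s and e_j picks entry j
   of y_r, which explains the crossed indices. *)
have XY : (\mxrow_r JX wk r)^T *m \mxrow_r JY wk r = BXY.
  rewrite gram_mxrow; apply: eq_mxblock => r s; apply/matrixP => i j.
  by rewrite !mxE big_ord1 !entryE !mxE; ring.
have XZ : (\mxrow_r JX wk r)^T *m \mxrow_r JZ wk r = BXZ.
  rewrite gram_mxrow; apply: eq_mxblock => r s; apply/matrixP => i j.
  by rewrite !mxE big_ord1 !entryE !mxE; ring.
have YZ : (\mxrow_r JY wk r)^T *m \mxrow_r JZ wk r = BYZ.
  rewrite gram_mxrow; apply: eq_mxblock => r s; apply/matrixP => i j.
  by rewrite !mxE big_ord1 !entryE !mxE; ring.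
rewrite /A Jacobian_residual !tr_row_mx !mul_col_row !mul_col_mx.
(* Back in product form, the transposed blocks below the diagonal become products in reverse
   order. *)
rewrite -XX -YY -ZZ -XY -XZ -YZ !trmx_mul !trmxK.
by rewrite mul_mx_row /block_mx -block_mxEh.
Qed.
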